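(* Let $k,\ell,n$ be positive integers with $k+\ell-3\le n<(k-1)(\ell-1)$. Then $s^{(c)}_n(k,\ell)<s^{(c)}_{n+1}(k,\ell)$, where $s^{(c)}_m(k,\ell)$ denotes the number of $(k,\ell)$-right-crucial permutations of length $m$.
   Context: $i_m=12\cdots m$ and $d_m=m(m-1)\cdots 1$; a permutation (in one-line notation) contains $i_m$ (resp. $d_m$) if it has an increasing (resp. decreasing) subsequence of length $m$, and avoids it otherwise. The extensions of a permutation $\sigma=\sigma_1\cdots\sigma_n$ of $\{1,\ldots,n\}$ to the right are the $n+1$ permutations $e_t(\sigma_1)\cdots e_t(\sigma_n)\,t$ of $\{1,\ldots,n+1\}$, $1\le t\le n+1$, where $e_t(x)=x$ if $x<t$ and $e_t(x)=x+1$ if $x\ge t$. A permutation is $(k,\ell)$-right-crucial (also called $(k,\ell)$-crucial) if it avoids $i_k$ and $d_\ell$ but each of its extensions to the right contains $i_k$ or $d_\ell$. *)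

(* Defs.v *)
From mathcomp Require Import all_boot all_fingroup.
Set Implicit Arguments.
Unset Strict Implicit.
Unset Printing Implicit Defensive.

(* The permutations of {1, ..., n} are the elements of 'S_n, positions and
   values being numbered from 0 and not from 1. A subsequence of the one-line
   notation of s is given by its set A of positions. *)

Definition contains_incr (n : nat) (s : 'S_n) (m : nat) : bool :=
  [exists A : {set 'I_n}, (#|A| == m) &&
    [forall i in A, forall j in A, (i < j) ==> (s i < s j)]].

Definition contains_decr (n : nat) (s : 'S_n) (m : nat) : bool :=
  [exists A : {set 'I_n}, (#|A| == m) &&
    [forall i in A, forall j in A, (i < j) ==> (s j < s i)]].

(* lift_perm ord_max t s sends the last position ord_max to t, and every other
   position i to lift t (s i), whose value is s i if s i < t and (s i).+1 if
   s i >= t. *)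
Definition right_extension (n : nat) (s : 'S_n) (t : 'I_n.+1) : 'S_n.+1 :=
  lift_perm ord_max t s.

Definition right_crucial (k l n : nat) (s : 'S_n) : bool :=
  [&& ~~ contains_incr s k, ~~ contains_decr s l
    & [forall t : 'I_n.+1, contains_incr (right_extension s t) k
                        || contains_decr (right_extension s t) l]].

Definition num_right_crucial (n k l : nat) : nat :=
  #|[set s : 'S_n | right_crucial k l s]|.

(* Main.v *)
Require Import Defs.
From mathcomp Require Import all_boot all_fingroup.
From mathcomp Require Import zify.

(** The proof goes through the Robinson-Schensted correspondence, which sends a
    permutation to its insertion tableau P and its recording tableau Q, of the
    same shape. By Schensted's theorem ([avoids_fits]), a permutation avoids the
    increasing pattern of length k and the decreasing pattern of length l
    exactly when the shape of P lies in the rectangle with k-1 columns and l-1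
    rows. Extending a permutation to the right inserts one more letter in P, so
    being right-crucial is a property of P alone ([right_crucialP]): P lies in
    the rectangle, but leaves it whatever letter is inserted.

    Let P be crucial, with n cells and letters 0, ..., n-1. As n is less than
    the area of the rectangle, some row of P is not full; add the letter n at
    the end of the first such row, and add n at the same cell in Q. A cell
    added to a tableau can only enlarge the result of a later insertion
    ([fits_insert_append]), so the new P is again crucial. Removing n from both
    tableaux gives the old pair back, so this is an injection from the crucial
    permutations of length n to those of length n+1 ([crucial_grow]).

    It is not onto, because in its image the insertion tableau without its
    largest letter is still crucial. For k = m+2 and l = p+2, fill p rows of
    width m with consecutive letters, as far as they go, the overflow going to
    one more row, and close each of the p rows with one of the p next letters,
    increasing downwards. Inserting the letter that closes the first row pushes
    the closing letters down by one row and stays in the rectangle, so that this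
    tableau is not crucial. But put a still larger letter at the end of its row
    of index p: now an inserted letter either makes the first row too long or
    bumps a letter in all p+1 rows, because each row ends with a larger letter
    than the row above, and so opens one row too many
    ([exists_ungrown_crucial]).

    A right extension by t amounts to appending to the word a letter equal to t
    without shifting the others, if a repeated letter counts as a descent. So
    words may have repeated letters here: increasing means strictly increasing,
    decreasing means weakly decreasing, and tableaux have strictly increasing
    rows and weakly increasing columns. The recording tableau is kept as the
    list of the indices of the rows that successively receive a new cell. *)

Set Implicit Arguments.
Unset Strict Implicit.
Unset Printing Implicit Defensive.

(** * Chains in words and Knuth moves *)

Definition chain (r : rel nat) (m : nat) (w : seq nat) : Prop :=
  exists s : seq nat, [/\ subseq s w, pairwise r s & size s = m].

Lemma subseq_cat_split (s u v : seq nat) :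
  subseq s (u ++ v) ->
  exists s1 s2, [/\ s = s1 ++ s2, subseq s1 u & subseq s2 v].
Proof.
move=> /subseqP[b sb ->]; rewrite -(cat_take_drop (size u) b) mask_cat.
  by eexists; eexists; split; [by []| |]; apply: mask_subseq.
by rewrite size_takel // sb size_cat leq_addr.
Qed.

Lemma chain_leq r m m' w : m' <= m -> chain r m w -> chain r m' w.
Proof.
move=> le_m [s [sw ps sz]]; exists (take m' s); split.
- exact: subseq_trans (take_subseq _ _) sw.
- exact: subseq_pairwise (take_subseq _ _) ps.
- by rewrite size_takel // sz.
Qed.

(** Only pairs of letters in the order in which they occur in [w] matter, so
    that [f] and [g] may compare differently on pairs that occur in the other
    order. This is what lets a word with a repeated letter be compared with a
    word without repetition. *)
Lemma chain_map (r1 r2 : rel nat) (f g : nat -> nat) m w :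
  pairwise (fun a b => r1 (f a) (f b) ==> r2 (g a) (g b)) w ->
  chain r1 m (map f w) -> chain r2 m (map g w).
Proof.
move=> pw [s [/subseqP[b sb ->] ps sz]]; exists (map g (mask b w)).
move: ps sz; rewrite -map_mask !size_map !pairwise_map => ps sz.
split => //; first by rewrite map_mask mask_subseq.
move: (subseq_pairwise (mask_subseq b w) pw) ps => {pw}.
move: (mask b w) => s0; elim: s0 => //= a s0 IH /andP[h1 h2] /andP[h3 h4].
rewrite IH // andbT; apply/allP => c cs.
exact: (implyP (allP h1 c cs)) (allP h3 c cs).
Qed.

(** A chain of [w1] can be traded for one of [w2] of the same length that fits
    wherever the first one fits: whatever precedes or follows the letters of
    the first also precedes or follows those of the second. *)
Definition refines (r : rel nat) (w1 w2 : seq nat) : Prop :=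
  forall s, subseq s w1 -> pairwise r s ->
  exists s', [/\ subseq s' w2, pairwise r s', size s' = size s &
    forall d, (all (r d) s -> all (r d) s') /\
              (all (r^~ d) s -> all (r^~ d) s')].

Lemma chain_refines r w1 w2 u v m :
  refines r w1 w2 -> chain r m (u ++ w1 ++ v) -> chain r m (u ++ w2 ++ v).
Proof.
move=> ref [s [/subseq_cat_split[s1 [s' [-> s1u]]]]].
move=> /subseq_cat_split[s2 [s3 [-> s2w s3v]]].
rewrite !pairwise_cat !allrel_catr.
move=> /and3P[/andP[r12 r13] p1 /and3P[r23 p2 p3]].
have [s4 [s4w p4 sz4 d4]] := ref s2 s2w p2.
move=> sz; exists (s1 ++ s4 ++ s3); split.
- by rewrite !cat_subseq.
- rewrite !pairwise_cat !allrel_catr p1 p3 p4 r13 !andbT /=.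
  apply/andP; split.
    apply/allrelP => a b a1; have [h _] := d4 a.
    by apply/allP/h/allP => c; move/allrelP: r12; apply.
  apply/allrelP => a b a4 b3; have [_ h] := d4 b.
  suff /allP/(_ a a4) : all (r^~ b) s4 by [].
  by apply: h; apply/allP => c c2; move/allrelP: r23; apply.
- by rewrite -sz !size_cat sz4.
Qed.

(** Swapping [a] and [b] only loses the chains that use both. Such a chain
    cannot use the neighbour [c], which can then replace [a]. *)
Lemma refines_swapr (r : rel nat) a b c :
  (r a b -> [/\ ~~ r c a, r c b, (forall d, r d a -> r d c)
                & forall d, r b d -> r c d]) ->
  refines r [:: c; a; b] [:: c; b; a].
Proof.
move=> H s /subseqP[[|x[|y[|z[|? ?]]]] //= _ ->] ps.
case: x ps; case: y; case: z => //= ps.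
- by move: ps => /and3P[/and3P[ca _ _] /andP[/H[nca _ _ _] _] _]; rewrite ca in nca.
- by exists [:: c; a]; split => //; exact: (mask_subseq [:: true; false; true] [:: c; b; a]).
- by exists [:: c; b]; split => //; exact: (mask_subseq [:: true; true; false] [:: c; b; a]).
- by exists [:: c]; split => //; exact: (mask_subseq [:: true; false; false] [:: c; b; a]).
- have /H[_ cb h1 h2] : r a b by case/andP: ps => /andP[].
  exists [:: c; b]; split => //=.
  + exact: (mask_subseq [:: true; true; false] [:: c; b; a]).
  + by rewrite cb.
  + by move=> d; split => /and3P[h h' _]; rewrite ?h' ?(h1 _ h) ?(h2 _ h') ?h.
- by exists [:: a]; split => //; exact: (mask_subseq [:: false; false; true] [:: c; b; a]).
- by exists [:: b]; split => //; exact: (mask_subseq [:: false; true; false] [:: c; b; a]).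
- by exists [::].
Qed.

(** The mirror image of [refines_swapr]: here [c] replaces [b]. *)
Lemma refines_swapl (r : rel nat) a b c :
  (r a b -> [/\ ~~ r b c, r a c, (forall d, r d a -> r d c)
                & forall d, r b d -> r c d]) ->
  refines r [:: a; b; c] [:: b; a; c].
Proof.
move=> H s /subseqP[[|x[|y[|z[|? ?]]]] //= _ ->] ps.
case: x ps; case: y; case: z => //= ps.
- by move: ps => /and3P[/and3P[/H[nbc _ _ _] _ _] /andP[bc _] _]; rewrite bc in nbc.
- have /H[_ ac h1 h2] : r a b by case/andP: ps => /andP[].
  exists [:: a; c]; split => //=.
  + exact: (mask_subseq [:: false; true; true] [:: b; a; c]).
  + by rewrite ac.
  + by move=> d; split => /and3P[h h' _]; rewrite ?h' ?(h1 _ h) ?(h2 _ h') ?h.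
- by exists [:: a; c]; split => //; exact: (mask_subseq [:: false; true; true] [:: b; a; c]).
- by exists [:: a]; split => //; exact: (mask_subseq [:: false; true; false] [:: b; a; c]).
- by exists [:: b; c]; split => //; exact: (mask_subseq [:: true; false; true] [:: b; a; c]).
- by exists [:: b]; split => //; exact: (mask_subseq [:: true; false; false] [:: b; a; c]).
- by exists [:: c]; split => //; exact: (mask_subseq [:: false; false; true] [:: b; a; c]).
- by exists [::].
Qed.

Definition monotone (incr : bool) : rel nat := if incr then ltn else geq.

(** The consequence of Knuth equivalence that Schensted's theorem needs; the
    context makes it a congruence for concatenation. *)
Definition same_chains (w1 w2 : seq nat) : Prop :=
  forall incr u v m, chain (monotone incr) m (u ++ w1 ++ v) <->
                     chain (monotone incr) m (u ++ w2 ++ v).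

Lemma same_chains_trans w1 w2 w3 :
  same_chains w1 w2 -> same_chains w2 w3 -> same_chains w1 w3.
Proof. by move=> h1 h2 i u v m; rewrite h1 h2. Qed.

Lemma same_chains_cat u v w1 w2 :
  same_chains w1 w2 -> same_chains (u ++ w1 ++ v) (u ++ w2 ++ v).
Proof.
move=> h i u' v' m; have := h i (u' ++ u) (v ++ v') m.
by rewrite -!catA.
Qed.

Lemma same_chains_catl u w1 w2 :
  same_chains w1 w2 -> same_chains (u ++ w1) (u ++ w2).
Proof. by move=> /(same_chains_cat u [::]); rewrite !cats0. Qed.

Lemma same_chains_knuth_right x y z :
  x <= y < z -> same_chains [:: y; z; x] [:: y; x; z].
Proof.
move=> xyz [] u v m; split; apply: chain_refines; apply: refines_swapr; rewrite /monotone /=;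
  by move=> h; split; try (move=> d); lia.
Qed.

Lemma same_chains_knuth_left x y z :
  x < y <= z -> same_chains [:: x; z; y] [:: z; x; y].
Proof.
move=> xyz [] u v m; split; apply: chain_refines; apply: refines_swapl; rewrite /monotone /=;
  by move=> h; split; try (move=> d); lia.
Qed.

(** * Row insertion *)

Fixpoint row_insert (t : nat) (r : seq nat) : option nat * seq nat :=
  if r is y :: r1 then
    if t <= y then (Some y, t :: r1)
    else let: (o, r2) := row_insert t r1 in (o, y :: r2)
  else (None, [:: t]).

Lemma row_insert_None t r r2 : row_insert t r = (None, r2) ->
  r2 = rcons r t /\ all (ltn^~ t) r.
Proof.
elim: r r2 => [|y r IH] r2 /=; first by case=> <-.
case: leqP => // yt; case: (row_insert t r) IH => [o r'] IH [eo <-].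
rewrite eo in IH.
by have [-> ->] := IH _ erefl.
Qed.

Lemma row_insert_rcons t r : all (ltn^~ t) r ->
  row_insert t r = (None, rcons r t).
Proof. by elim: r => //= y r IH /andP[yt /IH ->]; rewrite leqNgt yt. Qed.

Lemma row_insert_Some t r x r2 : row_insert t r = (Some x, r2) ->
  [/\ t <= x, x \in r, t \in r2, size r2 = size r & perm_eq (x :: r2) (t :: r)].
Proof.
elim: r r2 => [|y r IH] r2 //=.
case: leqP => [ty [<- <-]|yt].
  by rewrite !inE !eqxx; split => //; apply/seq.permP => p /=; lia.
case: (row_insert t r) IH => [o r'] IH [eo <-]; rewrite eo in IH.
have [tx xr tr' sz /seq.permP h] := IH _ erefl.
rewrite !inE xr tr' !orbT /= sz; split => //.
by apply/seq.permP => p /=; have := h p; rewrite /=; lia.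
Qed.

Lemma row_insert_sorted t r x r2 : sorted ltn r ->
  row_insert t r = (Some x, r2) -> sorted ltn r2.
Proof.
have E: forall r, sorted ltn r = pairwise ltn r.
  by move=> ?; rewrite sorted_pairwise //; apply: ltn_trans.
rewrite !E; elim: r r2 => [|y r IH] r2 //= /andP[yr sr].
case: leqP => [ty [_ <-] /=|yt].
  by rewrite sr andbT; apply: sub_all yr => z /=; lia.
case eqi: (row_insert t r) => [o r'] [eo <-]; rewrite eo in eqi.
rewrite /= (IH _ sr eqi) andbT; apply/allP => z zr'.
have [_ _ _ _ /perm_mem/(_ z)] := row_insert_Some eqi.
rewrite !inE zr' orbT => /esym/orP[/eqP-> //|]; exact: (allP yr).
Qed.

(** A letter that bumps the head of a row first travels leftwards over the rest
    of the row, by Knuth moves whose witness is the next letter on the left. *)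
Lemma same_chains_slide t y r : t <= y -> path ltn y r ->
  same_chains (y :: r ++ [:: t]) (y :: t :: r).
Proof.
elim: r y => [|z r IH] y ty //= /andP[yz pr].
apply: same_chains_trans (same_chains_catl [:: y] (IH z _ pr)) _; first by lia.
apply: (same_chains_cat [::] r (same_chains_knuth_right _)); lia.
Qed.

(** Once the inserted letter has taken the place of [x], the letter [x] travels
    to the front of the row, by Knuth moves whose witness is the next letter on
    the right, which lies between the letter jumped over and [x]. *)
Lemma same_chains_row_insert t r x r2 : sorted ltn r ->
  row_insert t r = (Some x, r2) -> same_chains (r ++ [:: t]) (x :: r2).
Proof.
elim: r r2 => [|y r IH] r2 //= sr.
case: leqP => [ty [<- <-]|yt]; first exact: same_chains_slide.
case eqi: (row_insert t r) => [o r'] [eo <-]; rewrite eo in eqi => {eo o r2}.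
apply: same_chains_trans (same_chains_catl [:: y] (IH _ (path_sorted sr) eqi)) _.
(* [z] is the inserted letter, or a letter that it did not bump. *)
have [z [r3 [-> yzx]]] : exists z r3, r' = z :: r3 /\ y < z <= x.
  case: r eqi sr {IH} => [|z r] //=; case: (leqP t z) => [tz [<- <-]|zt].
    by move=> pz; exists t, r; split => //; lia.
  case eqi: (row_insert t r) => [o r3] [eo <-] pz; rewrite eo in eqi.
  have [tx _ _ _ _] := row_insert_Some eqi.
  by exists z, r3; split => //; lia.
exact: (same_chains_cat [::] r3 (same_chains_knuth_left yzx)).
Qed.

(** The second component is the index of the row that receives the new cell. *)
Fixpoint insert (t : nat) (T : seq (seq nat)) : seq (seq nat) * nat :=
  if T is r :: T1 then
    match row_insert t r with
    | (Some x, r2) => let: (T2, i) := insert x T1 in (r2 :: T2, i.+1)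
    | (None, r2) => (r2 :: T1, 0)
    end
  else ([:: [:: t]], 0).

(** The condition on the columns of two consecutive rows of a tableau, [r] being
    the upper one. *)
Fixpoint dominates (r s : seq nat) : bool :=
  match r, s with
  | _, [::] => true
  | x :: r1, y :: s1 => (x <= y) && dominates r1 s1
  | [::], _ :: _ => false
  end.

Fixpoint tableau (T : seq (seq nat)) : bool :=
  if T is r :: T1 then
    [&& r != [::], sorted ltn r, dominates r (head [::] T1) & tableau T1]
  else true.

Lemma dominates_size r s : dominates r s -> size s <= size r.
Proof. by elim: r s => [|x r IH] [|y s] //= /andP[_ /IH]. Qed.

Lemma dominates_mem r s x : dominates r s -> x \in s ->
  exists2 y, y \in r & y <= x.
Proof.
elim: r s => [|y r IH] [|z s] //= /andP[yz d].
rewrite inE => /predU1P[->|/(IH _ d)[w wr wx]].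
  by exists y; rewrite ?inE ?eqxx.
by exists w; rewrite // inE wr orbT.
Qed.

Lemma dominates_row_insert_left t r x r2 s : row_insert t r = (Some x, r2) ->
  dominates r s -> dominates r2 s.
Proof.
elim: r r2 s => [|y r IH] r2 //= s.
case: leqP => [ty [_ <-]|yt]; first by case: s => //= z s /andP[yz ->]; lia.
case eqi: (row_insert t r) => [o r'] [eo <-]; rewrite eo in eqi.
by case: s => //= z s /andP[-> /(IH _ _ eqi)].
Qed.

(** The columns survive bumping: [x] enters the lower row weakly to the left of
    the place it left, and its old place receives a letter that is no larger. *)
Lemma dominates_row_insert t r x r2 s o s2 : sorted ltn r ->
  row_insert t r = (Some x, r2) -> row_insert x s = (o, s2) ->
  dominates r s -> dominates r2 s2.
Proof.
elim: r r2 s s2 => [|y r IH] r2 //= s s2 sr.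
case: leqP => [ty [<- <-]|yt].
  case: s => [[_ <-] _|z s] /=; first by rewrite ty; case: (r).
  by move=> + /andP[yz d]; rewrite yz => -[_ <-] /=; rewrite ty.
case eqi: (row_insert t r) => [o' r'] [eo <-]; rewrite eo in eqi.
have [tx xr _ _ _] := row_insert_Some eqi.
case: s => [[_ <-] _|z s] /=; first by rewrite (ltnW (leq_trans yt tx)); case: (r').
case: leqP => [xz [_ <-]|zx] /=.
  by move=> /andP[_ /(dominates_row_insert_left eqi) ->]; lia.
case eqs: (row_insert x s) => [o2 s'] [eo2 <-] /andP[-> d] /=; rewrite eo2 in eqs.
exact: IH (path_sorted sr) eqi eqs d.
Qed.

Lemma dominates_rcons r s x : dominates r s -> dominates (rcons r x) s.
Proof. by elim: r s => [|y r IH] [|z s] //= /andP[-> /IH]. Qed.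

Lemma sorted_rcons r t : sorted ltn r -> all (ltn^~ t) r -> sorted ltn (rcons r t).
Proof.
rewrite !(sorted_pairwise ltn_trans) -cats1 pairwise_cat => -> h /=.
by rewrite andbT; apply/allrelP => x y xr; rewrite inE => /eqP->; apply: (allP h).
Qed.

Lemma tableau_insert t T : tableau T -> tableau (insert t T).1.
Proof.
elim: T t => [|r T IH] t //= /and4P[rn sr d tT].
case eqi: (row_insert t r) => [[x|] r2] /=; last first.
  have [-> h] := row_insert_None eqi.
  by rewrite tT dominates_rcons // sorted_rcons // -size_eq0 size_rcons.
have := IH x tT; have := dominates_row_insert sr eqi _ d.
have [_ _ _ sz _] := row_insert_Some eqi.
have sr2 := row_insert_sorted sr eqi.
have r2n : r2 != [::] by rewrite -size_eq0 sz size_eq0.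
case: T {IH tT d} => [|s T] /= h; first by rewrite r2n sr2 (h None).
case eqs: (row_insert x s) h => [[y|] s2] /(_ _ _ erefl) h.
  by case: (insert y T) => T2 i /= ->; rewrite r2n sr2 h.
by move=> /= ->; rewrite r2n sr2 h.
Qed.

(** Rows are read from the bottom up, which is the order in which the bumped
    letter leaves a row on its left and reaches the row below on its right. *)
Fixpoint reading (T : seq (seq nat)) : seq nat :=
  if T is r :: T1 then reading T1 ++ r else [::].

Lemma same_chains_insert t T : tableau T ->
  same_chains (reading T ++ [:: t]) (reading (insert t T).1).
Proof.
elim: T t => [|r T IH] t //= /and4P[_ sr _ tT].
case eqi: (row_insert t r) => [[x|] r2]; last first.
  by have [-> _] := row_insert_None eqi; rewrite -cats1 /= catA.
have := IH x tT; case: (insert x T) => T2 i /= h.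
rewrite -catA.
apply: same_chains_trans (same_chains_catl _ (same_chains_row_insert sr eqi)) _.
by have := same_chains_cat [::] r2 h; rewrite /= -catA.
Qed.

(** * Schensted's theorem *)

Lemma count_ltn_dominates v r s : dominates r s ->
  count (ltn^~ v) s <= count (ltn^~ v) r.
Proof. by elim: r s => [|x r IH] [|y s] //= /andP[xy /IH] /=; lia. Qed.

(** In the reading word, an increasing chain takes at most one letter from each
    column. In terms of rows: the letters taken from the lower rows are smaller
    than the first letter [w] taken from the first row, so their number is at
    most the number of letters less than [w] in the second row, hence in the
    first row, which still has the letters of the chain from [w] on. *)
Lemma increasing_bound v T (s : seq nat) : tableau T -> subseq s (reading T) ->
  pairwise ltn s -> all (ltn^~ v) s -> size s <= count (ltn^~ v) (head [::] T).
Proof.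
elim: T v s => [|r T IH] v s /=; first by move=> _ /eqP->.
move=> /and4P[_ sr d tT] /subseq_cat_split[s1 [s2 [-> s1T s2r]]].
rewrite pairwise_cat all_cat size_cat => /and3P[s12 p1 p2] /andP[a1 a2].
case: s2 s2r s12 p2 a2 => [|w s2] s2r s12 p2 a2.
  rewrite addn0; apply: leq_trans (count_ltn_dominates v d).
  exact: IH.
have /(IH w _ tT s1T p1) le1 : all (ltn^~ w) s1.
  by apply/allP => x x1; move/allrelP: s12; apply; rewrite // inE eqxx.
have le2 : size (w :: s2) <= count (fun x => w <= x < v) r.
  apply: leq_trans (leq_count_subseq _ s2r).
  rewrite leq_eqVlt eq_sym -all_count; apply/orP; left.
  apply/allP => x x2; rewrite (allP a2 x x2) andbT.
  move: x2 p2; rewrite inE => /predU1P[->//|x2 /= /andP[/allP/(_ x x2)]] /=.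
  by move=> /ltnW.
have := count_ltn_dominates w d.
have wv : w < v by case/andP: a2.
have : count (ltn^~ v) r = count (ltn^~ w) r + count (fun x => w <= x < v) r.
  by elim: (r) => //= x r' ->; lia.
move=> -> cw; rewrite leq_add //; exact: leq_trans le1 cw.
Qed.

(** A decreasing chain takes at most one letter from each row. *)
Lemma decreasing_bound T (s : seq nat) : tableau T -> subseq s (reading T) ->
  pairwise geq s -> size s <= size T.
Proof.
elim: T s => [|r T IH] s /=; first by move=> _ /eqP->.
move=> /and4P[_ sr _ tT] /subseq_cat_split[s1 [s2 [-> s1T s2r]]].
rewrite pairwise_cat size_cat => /and3P[_ p1 p2].
suff le1 : size s2 <= 1 by rewrite -addn1 leq_add // IH.
have := subseq_sorted ltn_trans s2r sr.
by case: s2 p2 {s2r} => [|x [|y s2]] //=; rewrite /geq /=; lia.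
Qed.

(** The chain is the first column; the bound on its letters is what allows the
    induction to prolong it by the head of a row above. *)
Lemma decreasing_column T : tableau T ->
  exists s, [/\ subseq s (reading T), pairwise geq s, size s = size T
    & all (leq (head 0 (head [::] T))) s].
Proof.
elim: T => [|r T IH] /=; first by exists [::].
move=> /and4P[]; case: r => // x r _ _ d tT; have [s [sT ps sz h]] := IH tT.
have xs : all (leq x) s.
  case: T d h tT {IH sT} sz => [|[|y r'] T1] //= => [_ _ _|/andP[xy _] h _ _].
    by move/size0nil->.
  by apply: sub_all h => z /=; exact: leq_trans.
exists (s ++ [:: x]); split.
- by rewrite cat_subseq //= eqxx sub0seq.
- rewrite pairwise_cat ps !andbT.
  by apply/allrelP => a b sa; rewrite inE => /eqP->; exact: (allP xs).
- by rewrite size_cat sz addn1.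
- by rewrite all_cat xs /= leqnn.
Qed.

Definition fits (k l : nat) (T : seq (seq nat)) : bool :=
  (size (head [::] T) < k) && (size T < l).

Lemma chain_reading T m incr : tableau T ->
  chain (monotone incr) m (reading T) <->
  m <= if incr then size (head [::] T) else size T.
Proof.
move=> tT; split=> [[s [sT ps <-]]|le_m].
  case: incr ps => ps; last exact: decreasing_bound.
  have := increasing_bound (v := (\max_(x <- s) x).+1) tT sT ps.
  have all_s : all (ltn^~ (\max_(x <- s) x).+1) s.
    by apply/allP => x xs /=; rewrite ltnS; apply: leq_bigmax_seq.
  by move=> /(_ all_s) /leq_trans; apply; exact: count_size.
apply: chain_leq le_m _; case: incr.
  exists (head [::] T); split => //; first by case: (T) => //= r T1; apply: suffix_subseq.
  by rewrite -(sorted_pairwise ltn_trans); case: T tT => //= r T /and4P[].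
by have [s [sT ps sz _]] := decreasing_column tT; exists s.
Qed.

Definition avoids (k l : nat) (w : seq nat) : Prop :=
  ~ chain ltn k w /\ ~ chain geq l w.

(** The insertion tableau of a word, together with the record of the rows that
    received the successive cells, which encodes the recording tableau. *)
Definition rsk (w : seq nat) : seq (seq nat) * seq nat :=
  foldl (fun p t => let: (T, i) := insert t p.1 in (T, rcons p.2 i))
        ([::], [::]) w.

Lemma rsk_rcons w t : rsk (rcons w t) =
  ((insert t (rsk w).1).1, rcons (rsk w).2 (insert t (rsk w).1).2).
Proof. by rewrite /rsk foldl_rcons; case: (insert t _). Qed.

Lemma tableau_rsk w : tableau (rsk w).1.
Proof. by elim/last_ind: w => // w t IH; rewrite rsk_rcons tableau_insert. Qed.

Lemma same_chains_rsk w : same_chains w (reading (rsk w).1).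
Proof.
elim/last_ind: w => // w t IH; rewrite rsk_rcons -cats1.
apply: same_chains_trans (same_chains_insert _ (tableau_rsk w)).
exact: (same_chains_cat [::]).
Qed.

(** Schensted's theorem: the first row of the insertion tableau measures the
    increasing chains and its first column the decreasing ones. *)
Lemma avoids_fits k l w : avoids k l w <-> fits k l (rsk w).1.
Proof.
have h i m : chain (monotone i) m w <-> m <= if i then size (head [::] (rsk w).1) else size (rsk w).1.
  rewrite -chain_reading; last exact: tableau_rsk.
  by have := same_chains_rsk w i [::] [::] m; rewrite !cats0.
rewrite /avoids (h true k) (h false l) /fits !ltnNge; split.
  by move=> [/negP-> /negP->].
by move=> /andP[/negP ? /negP].
Qed.

Lemma perm_insert t T : perm_eq (flatten (insert t T).1) (t :: flatten T).
Proof.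
elim: T t => [|r T IH] t //=.
case eqi: (row_insert t r) => [[x|] r2].
  have [_ _ _ _ /seq.permP h] := row_insert_Some eqi.
  have := IH x; case: (insert x T) => T2 i /= /seq.permP h2.
  apply/seq.permP => p; have := h p; have := h2 p.
  by rewrite /= !count_cat; lia.
have [-> _] := row_insert_None eqi.
by apply/seq.permP => p; rewrite /= -cats1 !count_cat /=; lia.
Qed.

Lemma perm_rsk w : perm_eq (flatten (rsk w).1) w.
Proof.
elim/last_ind: w => // w t IH; rewrite rsk_rcons /=.
apply: perm_trans (perm_insert _ _) _.
by rewrite perm_sym perm_rcons perm_cons perm_sym.
Qed.

(** The shape of a tableau as a function that vanishes past the last row, so
    that equality of shapes needs no comparison of lengths. *)
Definition row_size (T : seq (seq nat)) (i : nat) : nat := size (nth [::] T i).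

Lemma row_size_insert t T i :
  row_size (insert t T).1 i = ((insert t T).2 == i) + row_size T i.
Proof.
rewrite /row_size; elim: T t i => [|r T IH] t i /=.
  by case: i => [|i] //=; rewrite nth_nil.
case eqi: (row_insert t r) => [[x|] r2].
  have [_ _ _ sz _] := row_insert_Some eqi.
  by have := IH x; case: (insert x T) => T2 j /= h; case: i => [|i] /=; rewrite ?h.
have [-> _] := row_insert_None eqi.
by case: i => [|i] //=; rewrite size_rcons.
Qed.

Lemma tableau_row_size T i : tableau T -> row_size T i.+1 <= row_size T i.
Proof.
rewrite /row_size; elim: T i => [|r T IH] [|i] //= /and4P[_ _ d /IH] //.
by move=> _; have := dominates_size d; case: (T).
Qed.

Lemma tableau_row_gt0 T i : tableau T -> (0 < row_size T i) = (i < size T).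
Proof.
rewrite /row_size; elim: T i => [|r T IH] [|i] //= /and4P[rn _ _ tT].
  by rewrite lt0n size_eq0.
by rewrite IH.
Qed.

(** * Inverting the correspondence *)

(** The bumped letter determines where it came from: if two different places
    were possible in the resulting row, then the letter entering the row would
    be larger than the letter leaving it. *)
Lemma row_insert_inj t r t' r' p : sorted ltn r -> sorted ltn r' ->
  row_insert t r = p -> row_insert t' r' = p -> t = t' /\ r = r'.
Proof.
case: p => [[x|] r2]; last first.
  move=> _ _ /row_insert_None[-> _] /row_insert_None[/eqP].
  by rewrite eqseq_rcons => /andP[/eqP-> /eqP->].
(* the letter entering a sorted row is at most the letter leaving it *)
have aux y r0 t0 s0 : path ltn y r0 -> row_insert t0 s0 = (Some y, r0) -> False.
  move=> pr /row_insert_Some[ty _ tr _ _].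
  by have /allP/(_ _ tr) := order_path_min ltn_trans pr; rewrite /=; lia.
elim: r r' r2 => [|y r IH] [|y' r'] r2 //= sr sr'.
case: (leqP t y) => [ty|yt] e; case: (leqP t' y') => [ty'|yt'] e'.
- by case: e e' => <- <- [-> -> ->].
- case: e => ex e2; case eqi: (row_insert t' r') e' => [o r3] [eo e3].
  move: e2; rewrite -e3 => -[_ er]; rewrite eo -ex -er in eqi.
  by case: (aux _ _ _ _ sr eqi).
- case: e' => ex' e2'; case eqi: (row_insert t r) e => [o r3] [eo e3].
  move: e2'; rewrite -e3 => -[_ er]; rewrite eo -ex' -er in eqi.
  by case: (aux _ _ _ _ sr' eqi).
- case eqi: (row_insert t r) e => [o r3] [eo e3].
  case eqi': (row_insert t' r') e' => [o' r3'] [eo' e3'].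
  rewrite eo in eqi; rewrite eo' in eqi'.
  move: e3'; rewrite -e3 => -[-> er]; rewrite er in eqi'.
  by have [-> ->] := IH _ _ (path_sorted sr) (path_sorted sr') eqi eqi'.
Qed.

Lemma insert_inj t T t' T' p : tableau T -> tableau T' ->
  insert t T = p -> insert t' T' = p -> t = t' /\ T = T'.
Proof.
have none s u S : row_insert u s = (None, S) -> s != [::] -> size S = 1 -> False.
  move=> /row_insert_None[-> _]; rewrite size_rcons.
  by rewrite -size_eq0 => /negP h [/eqP].
elim: T t t' T' p => [|r T IH] t t' [|r' T'] p /=.
- by move=> _ _ <- [].
- move=> _ /and4P[rn _ _ _] <-.
  case eqi: (row_insert t' r') => [[x|] r2]; first by case: (insert x T').
  by case=> e2 _; case: (none _ _ _ eqi rn); rewrite e2.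
- move=> /and4P[rn _ _ _] _ + e; rewrite -e.
  case eqi: (row_insert t r) => [[x|] r2]; first by case: (insert x T).
  by case=> e2 _; case: (none _ _ _ eqi rn); rewrite e2.
move=> /and4P[_ sr _ tT] /and4P[_ sr' _ tT'].
case eqi: (row_insert t r) => [[x|] r2]; last first.
  move=> <-; case eqi': (row_insert t' r') => [[x'|] r2'].
    by case: (insert x' T').
  move=> [e2 ->]; rewrite e2 in eqi'.
  by have [-> ->] := row_insert_inj sr sr' eqi eqi'.
case ex: (insert x T) => [T2 i] <-.
case eqi': (row_insert t' r') => [[x'|] r2'] //.
case ex': (insert x' T') => [T2' i'] [e2 eT ei].
rewrite eT ei in ex'; have [exx ->] := IH _ _ _ _ tT tT' ex ex'.
by rewrite -exx e2 in eqi'; have [-> ->] := row_insert_inj sr sr' eqi eqi'.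
Qed.

Lemma rsk_inj : injective rsk.
Proof.
have size_rsk w : size (rsk w).2 = size w.
  by elim/last_ind: w => // w t IH; rewrite rsk_rcons !size_rcons IH.
move=> w w' e; have := size_rsk w; rewrite e size_rsk => sz.
elim/last_ind: w w' e sz => [|w t IH] w'; first by case: w'.
case/lastP: w' => [|w' t']; rewrite ?size_rcons // !rsk_rcons => -[eT ey] [sz].
move/eqP: ey; rewrite eqseq_rcons => /andP[/eqP ey /eqP ei].
have eqi : insert t (rsk w).1 = insert t' (rsk w').1.
  by move: eT ei; do 2!case: (insert _ _) => ? ? /=; move=> -> ->.
have [-> eT'] := insert_inj (tableau_rsk w) (tableau_rsk w') eqi erefl.
rewrite (IH w') //; move: eT' ey.
by case: (rsk w) => ? ?; case: (rsk w') => ? ? /= -> ->.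
Qed.

(** Reverse bumping: [x] takes the place of the last letter of the row that is
    at most [x]. *)
Lemma row_uninsert x r : sorted ltn r -> has (geq x) r ->
  exists t r', [/\ row_insert t r' = (Some x, r), sorted ltn r' & size r' = size r].
Proof.
elim: r => [|y r IH] //= sr /orP h.
case hr: (has (geq x) r).
  have [t [r' [eqi sr' sz]]] := IH (path_sorted sr) hr.
  have [tx xr' tr _ /perm_mem pm] := row_insert_Some eqi.
  have yr := order_path_min ltn_trans sr.
  have yt : y < t := allP yr t tr.
  exists t, (y :: r'); rewrite /= leqNgt yt eqi sz; split => //.
  rewrite (path_sortedE ltn_trans) sr' andbT; apply/allP => z zr'.
  have := pm z; rewrite !inE zr' orbT => /orP[/eqP->|]; last exact: (allP yr).
  exact: leq_trans yt tx.
have {h} yx : y <= x by case: h => //; rewrite hr.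
exists y, (x :: r); rewrite /= yx; split => //.
rewrite (path_sortedE ltn_trans) (path_sorted sr) andbT.
by move/hasPn: (negbT hr) => h; apply/allP => z /h /=; rewrite -ltnNge.
Qed.

Lemma dominates_row_uninsert_left t r' x r s :
  row_insert t r' = (Some x, r) -> dominates r s -> all (leq x) s ->
  dominates r' s.
Proof.
elim: r' r s => [|y r' IH] r //= s.
case: leqP => [ty [-> <-]|yt].
  by case: s => //= z s /andP[_ ->] /andP[->].
case eqi: (row_insert t r') => [o r1] [eo <-]; rewrite eo in eqi.
by case: s => //= z s /andP[-> d] /andP[_ /(IH _ _ eqi d)].
Qed.

Lemma row_insert_mem t r o r2 : row_insert t r = (o, r2) -> t \in r2.
Proof.
case: o => [x /row_insert_Some[]//|/row_insert_None[-> _]].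
by rewrite mem_rcons mem_head.
Qed.

(** The columns survive reverse bumping as well. *)
Lemma dominates_row_uninsert t r' x r s' o s : sorted ltn r' -> sorted ltn s' ->
  row_insert t r' = (Some x, r) -> row_insert x s' = (o, s) ->
  dominates r s -> dominates r' s'.
Proof.
elim: r' r s' s => [|y r' IH] r //= [|z s'] s // sr ss.
case: leqP => [ty [eyx <-]|yt] /=.
  rewrite eyx in sr *.
  case: leqP => [xz [_ <-]|zx] /=; first by case/andP.
  case eqs: (row_insert x s') => [o' s1] [_ <-] /= /andP[_ d].
  have [w wr wx] := dominates_mem d (row_insert_mem eqs).
  by have := allP (order_path_min ltn_trans sr) w wr; rewrite /=; lia.
case eqi: (row_insert t r') => [o' r1] [eo <-]; rewrite eo in eqi.
have [tx _ _ _ _] := row_insert_Some eqi.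
case: leqP => [xz [_ <-]|zx] /=.
  move=> /andP[yx d]; rewrite (leq_trans yx xz).
  apply: dominates_row_uninsert_left eqi d _.
  by apply: sub_all (order_path_min ltn_trans ss) => u /=; lia.
case eqs: (row_insert x s') => [o2 s1] [eo2 <-] /= /andP[-> d].
rewrite eo2 in eqs.
exact: IH (path_sorted sr) (path_sorted ss) eqi eqs d.
Qed.

Lemma dominates_rcons_inv r s x : size s <= size r ->
  dominates (rcons r x) s -> dominates r s.
Proof.
elim: r s => [|y r IH] [|z s] //= le_s /andP[-> d].
exact: IH d.
Qed.

(** Any tableau results from an insertion that ended at any prescribed corner:
    remove the corner and bump its letter back up through the rows. The column
    condition provides in each row a letter that can be bumped out. *)
Lemma insert_surj T1 i : tableau T1 -> row_size T1 i.+1 < row_size T1 i ->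
  exists t T, tableau T /\ insert t T = (T1, i).
Proof.
rewrite /row_size; elim: T1 i => [|r T1 IH] [|i] //= /and4P[rn sr d tT1].
  rewrite nth0; case/lastP: r rn sr d => // r t _ sr d.
  rewrite size_rcons ltnS => sz; exists t.
  have /andP[sr' rt] : sorted ltn r && all (ltn^~ t) r.
    move: sr; rewrite !(sorted_pairwise ltn_trans) -cats1 pairwise_cat.
    move=> /and3P[h -> _]; apply/allP => x xr.
    by move/allrelP: h; apply; rewrite ?mem_head.
  case: (eqVneq r [::]) sz => [er|rn] sz.
    exists [::]; rewrite er; split => //=.
    case: T1 sz tT1 {IH d} => //= s T1.
    by rewrite er leqn0 size_eq0 => /eqP->.
  exists (r :: T1); rewrite /= row_insert_rcons // rn sr' tT1.
  by rewrite (dominates_rcons_inv sz d).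
move=> lt; have [x [T [tT eqT]]] := IH i tT1 lt.
have xT1 : x \in head [::] T1.
  have -> : T1 = (insert x T).1 by rewrite eqT.
  case: (T) => [|s T2] /=; first by rewrite mem_head.
  case eqs: (row_insert x s) => [[y|] s2] /=; last exact: row_insert_mem eqs.
  by case: (insert y T2) => ? ?; exact: row_insert_mem eqs.
have hr : has (geq x) r.
  by have [y yr yx] := dominates_mem d xT1; apply/hasP; exists y.
have [t [r' [eqi sr' sz]]] := row_uninsert sr hr.
exists t, (r' :: T); rewrite /= eqi eqT; split => //.
rewrite tT sr' andbT -size_eq0 sz size_eq0 rn /=.
case: T tT eqT => [|s T2] //= => [_ _|/and4P[_ ss _ _]]; first by case: (r').
case eqs: (row_insert x s) => [[y|] s2] eqT.
  move: eqT; case: (insert y T2) => ? ? [eT _].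
  by apply: dominates_row_uninsert sr' ss eqi eqs _; move: d; rewrite -eT.
case: eqT => eT _.
by apply: dominates_row_uninsert sr' ss eqi eqs _; move: d; rewrite -eT.
Qed.

(** Within the tableaux of a given shape, the insertion tableau can be changed
    freely without changing the record, because the corners to be removed
    depend on the shape only. *)
Lemma rsk_surj w T : tableau T -> row_size T =1 row_size (rsk w).1 ->
  exists w', rsk w' = (T, (rsk w).2).
Proof.
elim/last_ind: w T => [|w t IH] T tT.
  move=> h; exists [::]; case: T tT h => //= r T tT /(_ 0) /=.
  by have := @tableau_row_gt0 (r :: T) 0 tT => + h; rewrite h.
rewrite rsk_rcons /= => h.
set i := (insert _ _).2 in h *.
have hi j : row_size T j = (i == j) + row_size (rsk w).1 j.
  by rewrite h row_size_insert.
have corner : row_size T i.+1 < row_size T i.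
  by have := tableau_row_size i (tableau_rsk w); rewrite !hi eqxx; lia.
have [u [T' [tT' eqT]]] := insert_surj tT corner.
have [j|w' ew'] := IH T' tT'.
  have := row_size_insert u T' j; rewrite eqT /= hi; lia.
by exists (rcons w' u); rewrite rsk_rcons ew' /= eqT.
Qed.

(** Here the record does not matter, so the last cell of the last row, which is
    always a corner, is removed each time. *)
Lemma rsk_tableau_surj T : tableau T -> exists w, (rsk w).1 = T.
Proof.
elim: {T}(size (flatten T)) {-2}T (erefl (size (flatten T))) => [|m IH] T szT tT.
  case: T tT szT => [|[|x r] T] //=; by exists [::].
have corner : row_size T (size T).-1.+1 < row_size T (size T).-1.
  case: T tT szT => //= r T tT _.
  have := @tableau_row_gt0 (r :: T) (size T) tT; rewrite /= ltnSn.
  by rewrite /row_size /= (nth_default _ (leqnn _)).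
have [t [T' [tT' eqT]]] := insert_surj tT corner.
have [||w ew] := IH T' => //.
  have /perm_size := perm_insert t T'; rewrite eqT /= szT; lia.
by exists (rcons w t); rewrite rsk_rcons ew eqT.
Qed.

(** * Adding a cell to a crucial tableau *)

Definition crucial_tableau (k l : nat) (T : seq (seq nat)) : Prop :=
  fits k l T /\ forall t, ~~ fits k l (insert t T).1.

Definition append_cell (i v : nat) (T : seq (seq nat)) : seq (seq nat) :=
  set_nth [::] T i (rcons (nth [::] T i) v).

Lemma dominates_rcons_lt r s v : all (ltn^~ v) r -> size s < size r ->
  dominates r s -> dominates r (rcons s v).
Proof.
elim: r s => [|x r IH] [|y s] //= /andP[xv rv] sz.
  by rewrite (ltnW xv); case: (r).
by move=> /andP[-> /IH]; apply.
Qed.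

Lemma tableau_append_cell i v T : tableau T -> all (ltn^~ v) (flatten T) ->
  (i == 0) || (row_size T i < row_size T i.-1) -> tableau (append_cell i v T).
Proof.
rewrite /append_cell /row_size.
elim: T i => [|r T IH] [|i] //=; first by case: i.
  move=> /and4P[rn sr d tT]; rewrite all_cat => /andP[rv _] _.
  by rewrite -size_eq0 size_rcons sorted_rcons // dominates_rcons.
move=> /and4P[rn sr d tT]; rewrite all_cat => /andP[rv Tv] lt.
rewrite rn sr IH //=; last by case: (i) lt.
rewrite andbT; case: i lt => [|i] /=; last by case: (T) d => //=; case: (i).
by rewrite nth0 => lt; case: (T) d lt => [|s T'] d lt; apply: dominates_rcons_lt.
Qed.

Lemma row_insert_Some_rcons t r x r2 v : row_insert t r = (Some x, r2) ->
  row_insert t (rcons r v) = (Some x, rcons r2 v).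
Proof.
elim: r r2 => [|y r IH] r2 //=.
case: leqP => [_ [-> <-]|_] //.
case eqi: (row_insert t r) => [o r'] [eo <-]; rewrite eo in eqi.
by rewrite (IH _ eqi).
Qed.

Lemma size_insert t T : maxn 1 (size T) <= size (insert t T).1.
Proof.
elim: T t => [|r T IH] t //=.
case: (row_insert t r) => [[x|] r2] //=; last by lia.
by have := IH x; case: (insert x T) => T2 i /=; lia.
Qed.

(** The bumping path in the smaller tableau is followed in the larger one,
    except that, where it stops at the end of a row, it may go on by bumping the
    added letter. *)
Lemma size_insert_append t i v T :
  size (insert t T).1 <= size (insert t (append_cell i v T)).1.
Proof.
elim: T t i => [|r T IH] t i.
  by have := size_insert t (append_cell i v [::]); rewrite geq_max => /andP[].
case: i => [|i].
  rewrite /append_cell /=; case eqi: (row_insert t r) => [[x|] r2].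
    by rewrite (row_insert_Some_rcons v eqi); case: (insert x T).
  by have := size_insert t (rcons r v :: T); rewrite geq_max => /andP[].
rewrite /append_cell /= -/(append_cell i v T).
case eqi: (row_insert t r) => [[x|] r2] /=.
  have := IH x i; case: (insert x T) => T2 j /=.
  by case: (insert x _) => T3 j' /=.
by rewrite ltnS /append_cell size_set_nth leq_maxr.
Qed.

Lemma size_row_insert_rcons t r v :
  size (row_insert t r).2 <= size (row_insert t (rcons r v)).2.
Proof.
elim: r => [|y r IH] /=; first by case: (leqP t v).
case: (leqP t y) => _ /=; first by rewrite size_rcons.
by move: IH; case: (row_insert t r) => ? ?; case: (row_insert t (rcons r v)).
Qed.

Lemma head_insert t T : head [::] (insert t T).1 = (row_insert t (head [::] T)).2.
Proof.
case: T => //= r T; case: (row_insert t r) => [[x|] r2] //=.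
by case: (insert x T).
Qed.

Lemma fits_insert_append k l t i v T :
  fits k l (insert t (append_cell i v T)).1 -> fits k l (insert t T).1.
Proof.
move=> /andP[h1 h2]; apply/andP; split; last first.
  exact: leq_ltn_trans (size_insert_append _ _ _ _) h2.
apply: leq_ltn_trans h1; rewrite !head_insert.
case: i {h2} => [|i]; last by case: T => //= *; case: (leqP t v).
by case: T => [|r T]; apply: size_row_insert_rcons.
Qed.

Lemma crucial_append_cell k l i v T : crucial_tableau k l T ->
  fits k l (append_cell i v T) -> crucial_tableau k l (append_cell i v T).
Proof.
move=> [_ h] fT; split => // t; apply/negP => /fits_insert_append.
exact/negP.
Qed.

(** A row that becomes empty is dropped, which matters when the removed letter
    was alone in the last row. *)
Definition remove_letter (v : nat) (T : seq (seq nat)) : seq (seq nat) :=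
  [seq r <- [seq filter (predC1 v) r | r <- T] | r != [::]].

Lemma remove_append_cell i v T : tableau T -> v \notin flatten T ->
  i <= size T -> remove_letter v (append_cell i v T) = T.
Proof.
have same s : v \notin s -> filter (predC1 v) s = s.
  by move=> vs; apply/all_filterP/allP => x xs /=; apply: contraNneq vs => <-.
have id S : tableau S -> v \notin flatten S -> remove_letter v S = S.
  elim: S => //= r S IH /and4P[rn _ _ tS]; rewrite mem_cat negb_or.
  move=> /andP[vr vS]; rewrite /remove_letter /= same // rn.
  by congr cons; apply: IH.
rewrite /append_cell; elim: T i => [|r T IH] [|i] //=.
- by rewrite /remove_letter /= eqxx.
- move=> /and4P[rn _ _ tT]; rewrite mem_cat negb_or => /andP[vr vT] _.
  rewrite /remove_letter /= filter_rcons /= eqxx same // rn.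
  by congr cons; apply: id.
move=> /and4P[rn _ _ tT]; rewrite mem_cat negb_or => /andP[vr vT] le_i.
rewrite /remove_letter /= same // rn; congr cons; exact: IH.
Qed.

Lemma row_size_append i j v T :
  row_size (append_cell i v T) j = (i == j) + row_size T j.
Proof.
rewrite /row_size /append_cell nth_set_nth /= eq_sym.
by case: eqVneq => [->|]; rewrite ?size_rcons.
Qed.

Lemma flatten_append_cell i v T : i <= size T ->
  perm_eq (flatten (append_cell i v T)) (v :: flatten T).
Proof.
rewrite /append_cell; elim: T i => [|r T IH] [|i] //= le_i.
  by rewrite -cats1 -catA perm_sym -cat1s perm_catCA.
have /seq.permP h := IH i le_i.
by apply/seq.permP => p; have := h p; rewrite /= !count_cat /=; lia.
Qed.

Lemma size_full_rows k (T : seq (seq nat)) :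
  all (fun r => k <= size r) T -> k * size T <= size (flatten T).
Proof.
by elim: T => [|r T IH] /=; [rewrite muln0|rewrite size_cat mulnS => /andP[? /IH]; lia].
Qed.

(** The injection. The word [w'] is obtained by adding [n] at the end of row [i]
    of the insertion tableau and [i] to the record; the old insertion tableau
    is what remains without the letter [n]. *)
Lemma crucial_grow k l n w : 0 < k -> n < (k - 1) * (l - 1) ->
  perm_eq w (iota 0 n) -> crucial_tableau k l (rsk w).1 ->
  exists w' i, [/\ perm_eq w' (iota 0 n.+1), (rsk w').2 = rcons (rsk w).2 i,
    remove_letter n (rsk w').1 = (rsk w).1 & crucial_tableau k l (rsk w').1].
Proof.
move=> k0 lt_n pw cT.
have tT := tableau_rsk w; have pT := perm_trans (perm_rsk w) pw.
move: tT pT cT; set T := (rsk w).1 => tT pT cT.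
(* Row [i] is the first row that is not full, possibly the empty row below. *)
pose i := find (fun r => size r < k - 1) T.
have le_i : i <= size T by apply: find_size.
have szi : row_size T i < k - 1.
  rewrite /row_size; case: (ltnP i (size T)) => [lt_i|le_i'].
    have full : has (fun r => size r < k - 1) T by rewrite has_find.
    exact: (nth_find [::] full).
  by rewrite nth_default //=; case: (k - 1) lt_n.
have before j : j < i -> k - 1 <= row_size T j.
  by move=> lt_j; rewrite leqNgt; apply/negbT/(before_find [::] lt_j).
(* Otherwise the rows above it would cover the whole rectangle. *)
have lt_i : i < l - 1.
  have full : all (fun r => k - 1 <= size r) (take i T).
    apply/(all_nthP [::]) => j; rewrite size_takel // => lt_j.
    by rewrite nth_take //; exact: before.
  have := size_full_rows full; rewrite size_takel // => le1.
  have le2 : size (flatten (take i T)) <= n.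
    have /perm_size := pT; rewrite size_iota => <-.
    by rewrite -{2}(cat_take_drop i T) flatten_cat size_cat leq_addr.
  have := leq_ltn_trans (leq_trans le1 le2) lt_n.
  by rewrite ltn_mul2l => /andP[].
have mem_lt x : x \in flatten T -> x < n.
  by rewrite (perm_mem pT) mem_iota.
have nT : n \notin flatten T by apply/negP => /mem_lt; rewrite ltnn.
set T1 := append_cell i n T.
have corner0 : (i == 0) || (row_size T i < row_size T i.-1).
  by case: (posnP i) => // i0; rewrite (leq_trans szi) ?before //= ?prednK ?orbT.
have tT1 : tableau T1.
  by apply: tableau_append_cell => //; apply/allP => x /mem_lt.
have fT1 : fits k l T1.
  have /andP[fk fl] := cT.1; rewrite /fits -nth0 -/(row_size T1 0).
  rewrite row_size_append size_set_nth; apply/andP; split; last by lia.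
  move: szi fk; rewrite -nth0 -/(row_size T 0).
  by case: (i) => /=; lia.
have corner : row_size T1 i.+1 < row_size T1 i.
  by rewrite !row_size_append eqxx; have := tableau_row_size i tT; lia.
have [t [T' [tT' eqT]]] := insert_surj tT1 corner.
have [j|w' ew'] := @rsk_surj w T' tT'.
  by have := row_size_insert t T' j; rewrite eqT /= row_size_append => /addnI.
have e1 : rsk (rcons w' t) = (T1, rcons (rsk w).2 i).
  by rewrite rsk_rcons ew' /= eqT.
exists (rcons w' t), i; rewrite e1 /=; split => //.
- have := perm_rsk (rcons w' t); rewrite e1 perm_sym /= => /perm_trans; apply.
  apply: perm_trans (flatten_append_cell n le_i) _.
  by rewrite -[0 :: iota 1 n]/(iota 0 n.+1) -addn1 iotaD cats1 perm_sym perm_rcons perm_cons perm_sym.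
- exact: remove_append_cell.
- exact: crucial_append_cell.
Qed.

(** * A crucial tableau outside the image *)

(** The letters [a], ..., [a + N - 1] fill [p] rows of width [m] greedily, the
    overflow forming one more row, omitted if empty; then the rows of index
    less than [p] are closed by [X], [X + 1], ... *)
Fixpoint staircase (p m a N X : nat) : seq (seq nat) :=
  if p is q.+1 then
    rcons (iota a (minn m N)) X ::
      staircase q m (a + minn m N) (N - minn m N) X.+1
  else if N is 0 then [::] else [:: iota a N].

Lemma dominates_block a b s s' X X' :
  s' <= s -> a <= b -> b + s' <= X -> X <= X' ->
  dominates (rcons (iota a s) X) (iota b s') /\
  dominates (rcons (iota a s) X) (rcons (iota b s') X').
Proof.
have dominates_nil r : dominates r [::] by case: r.
elim: s' s a b => [|s' IH] [|s] a b //= le_s ab bX XX'; rewrite ?andbT.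
- by split.
- by rewrite !dominates_nil; split => //; lia.
have [||||h1 h2] := IH s a.+1 b.+1 => //; lia.
Qed.

Lemma all_iota_ltn a s x : a + s <= x -> all (ltn^~ x) (iota a s).
Proof. by move=> h; apply/allP => y; rewrite mem_iota /=; lia. Qed.

Lemma tableau_staircase p m a N X : a + N <= X -> N <= m * p.+1 ->
  tableau (staircase p m a N X).
Proof.
elim: p a N X => [|q IH] a N X aX Nm.
  by case: N aX Nm => //= N _ _; rewrite andbT; apply: (iota_ltn_sorted a N.+1).
rewrite /= IH; try lia.
rewrite -size_eq0 size_rcons sorted_rcons ?iota_ltn_sorted ?all_iota_ltn //=; last by lia.
rewrite andbT; case: q {IH} Nm => [|q] Nm /=.
  case e: (N - minn m N) => [|N']; first by case: (rcons _ _).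
  rewrite -e; have [||||//] := @dominates_block a (a + minn m N) (minn m N) (N - minn m N) X X; lia.
by have [||||//] := @dominates_block a (a + minn m N) (minn m N)
     (minn m (N - minn m N)) X X.+1; lia.
Qed.

Lemma perm_staircase p m a N X :
  perm_eq (flatten (staircase p m a N X)) (iota a N ++ iota X p).
Proof.
elim: p a N X => [|q IH] a N X; first by case: N => //= N; rewrite cats0.
rewrite /=; have /seq.permP h := IH (a + minn m N) (N - minn m N) X.+1.
apply/seq.permP => P; rewrite count_cat h -cats1 !count_cat /=.
by rewrite -[in RHS](subnKC (geq_minr m N)) iotaD count_cat; lia.
Qed.

Lemma row_size_staircase p m a N X : N <= m * p.+2 ->
  row_size (staircase p.+1 m a N X) p.+1 < row_size (staircase p.+1 m a N X) p.
Proof.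
rewrite /row_size; elim: p a N X => [|p IH] a N X Nm.
  rewrite [staircase _ _ _ _ _]/= [nth _ _ 0]/= size_rcons size_iota /=.
  by case e: (N - minn m N) => [|N'] //=; rewrite size_iota; lia.
rewrite [staircase _ _ _ _ _]/= -/(staircase p.+1 m _ _ X.+1) [X in X < _]/= [X in _ < X]/=.
by apply: IH; lia.
Qed.

Lemma row_insert_last t r x : all (ltn^~ t) r -> t <= x ->
  row_insert t (rcons r x) = (Some x, rcons r t).
Proof.
by elim: r => [|y r IH] /=; [move=> _ -> | rewrite ltnNge => /andP[/negbTE-> /IH h] /h ->].
Qed.

(** Each closing letter is bumped by the one above it, and the last of them
    finds only smaller letters in the last row. *)
Lemma size_insert_staircase p m a N X x : a + N <= x <= X ->
  size (insert x (staircase p m a N X)).1 = p.+1.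
Proof.
elim: p a N X x => [|q IH] a N X x aX.
  case: N aX => [|N] aX //.
  by rewrite /staircase /insert row_insert_rcons // all_iota_ltn; lia.
rewrite /= row_insert_last; [|by apply: all_iota_ltn; lia|by lia].
have := IH (a + minn m N) (N - minn m N) X.+1 X.
by case: (insert X _) => T i /= ->; lia.
Qed.

Lemma row_insert_le_last t r x : all (geq x) r -> t <= x ->
  exists y r2, row_insert t (rcons r x) = (Some y, r2) /\ y <= x.
Proof.
move=> h tx; elim: r h => [_|z r IH] /=; first by rewrite tx; exists x, [:: t].
move=> /andP[zx /IH[y [r2 [-> yx]]]].
by case: (leqP t z) => _; [exists z, (t :: rcons r x) | exists y, (z :: r2)].
Qed.

(** With [n] at the end of the row of index [p], the last letters of the rows
    increase downwards, so the inserted letter bumps a letter in every row. *)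
Lemma size_insert_staircase_append p m a N X x n : a + N <= X -> x <= X ->
  X + p <= n ->
  size (insert x (append_cell p n (staircase p m a N X))).1 = p.+2.
Proof.
elim: p a N X x => [|q IH] a N X x aX xX Xn.
  have -> : append_cell 0 n (staircase 0 m a N X) = [:: rcons (iota a N) n].
    by case: N aX.
  rewrite /=; have [||y [r2 [-> _]]] // := @row_insert_le_last x (iota a N) n; last by lia.
  by apply/allP => y; rewrite mem_iota /=; lia.
rewrite /append_cell /= -/(append_cell q n _).
have [||y [r2 [-> yX]]] // := @row_insert_le_last x (iota a (minn m N)) X.
  by apply/allP => y; rewrite mem_iota /=; lia.
have := IH (a + minn m N) (N - minn m N) X.+1 y.
by case: (insert y _) => T i /= ->; lia.
Qed.

(** The parameters of the staircase are chosen so that its first row has [k - 1]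
    cells and its [l - 1] rows, the last one being possibly empty, have [n]
    cells. *)
Lemma exists_ungrown_crucial k l n : k + l <= n + 3 -> n < (k - 1) * (l - 1) ->
  exists w, [/\ perm_eq w (iota 0 n.+1), crucial_tableau k l (rsk w).1
    & ~ crucial_tableau k l (remove_letter n (rsk w).1)].
Proof.
move=> hkln hnkl.
(* The hypotheses force both k and l to be at least 3. *)
have [m [p [ek el]]] : exists m p, k = m.+3 /\ l = p.+3.
  exists (k - 3), (l - 3).
  case: k hkln hnkl => [|[|[|k]]]; case: l => [|[|[|l]]]; lia.
rewrite {}ek {}el in hkln hnkl * => {k l}.
pose N := n - p.+1; have eN : n = N + p.+1 by lia.
have Nm : N <= m.+1 * p.+2 by nia.
pose S := staircase p.+1 m.+1 0 N N.
have tS : tableau S by apply: tableau_staircase.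
have pS : perm_eq (flatten S) (iota 0 n).
  by rewrite eN iotaD; apply: perm_staircase.
have mem_lt x : x \in flatten S -> x < n.
  by rewrite (perm_mem pS) mem_iota.
have size_S : size S <= p.+2.
  apply: leq_trans (_ : size (insert N S).1 <= _).
    exact: leq_trans (leq_maxr 1 _) (size_insert N S).
  by rewrite size_insert_staircase ?leqnn.
have le_p : p.+1 <= size S.
  have := tableau_row_gt0 p tS; have := row_size_staircase 0 N Nm.
  by rewrite -/S => /(leq_ltn_trans (leq0n _)) -> /esym.
pose T := append_cell p.+1 n S.
have tT : tableau T.
  apply: tableau_append_cell => //; first by apply/allP => x /mem_lt.
  exact: row_size_staircase.
have hS : head [::] S = rcons (iota 0 m.+1) N.
  by rewrite /= (minn_idPl _) //; lia.
have hT : head [::] T = rcons (iota 0 m.+1) N by [].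
have [w ew] := rsk_tableau_surj tT.
exists w; rewrite ew; split.
- have := perm_rsk w; rewrite ew perm_sym => /perm_trans; apply.
  apply: perm_trans (flatten_append_cell n le_p) _.
  by rewrite -addn1 iotaD cats1 perm_sym perm_rcons perm_cons perm_sym.
- split.
    rewrite /fits hT size_rcons size_iota ltnSn size_set_nth.
    by rewrite ltnS geq_max size_S ltnSn.
  move=> t; case: (leqP t N) => tN; rewrite /fits negb_and -!leqNgt.
    by rewrite size_insert_staircase_append ?leqnn ?orbT //; lia.
  rewrite head_insert hT row_insert_rcons ?size_rcons ?size_iota ?leqnn //.
  by rewrite all_rcons /= tN; apply: (@all_iota_ltn 0 m.+1); lia.
have nS : n \notin flatten S by apply/negP => /mem_lt; rewrite ltnn.
rewrite remove_append_cell // => -[_ /(_ N)/negP]; apply.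
rewrite /fits head_insert hS size_insert_staircase ?leqnn // ?ltnSn ?andbT.
rewrite row_insert_last ?size_rcons ?size_iota //.
by apply: (@all_iota_ltn 0 m.+1); lia.
Qed.

(** * Permutations and words *)

Definition word (n : nat) (s : 'S_n) : seq nat := [seq val (s i) | i <- enum 'I_n].

Lemma pairwise_ord_lt n (r : rel 'I_n) (s : seq 'I_n) i j :
  pairwise r s -> pairwise (fun i j : 'I_n => i < j) s ->
  i \in s -> j \in s -> i < j -> r i j.
Proof.
elim: s => //= a s IH /andP[/allP ra ps] /andP[/allP la ls].
rewrite !inE => /predU1P[->|si] /predU1P[->|sj] ij; first by lia.
- exact: ra.
- by have := la _ si; rewrite /=; lia.
exact: IH.
Qed.

Lemma pairwise_enum_ord n : pairwise (fun i j : 'I_n => i < j) (enum 'I_n).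
Proof.
have := iota_ltn_sorted 0 n; rewrite (sorted_pairwise ltn_trans) -val_enum_ord.
by rewrite pairwise_map.
Qed.

Lemma word_chainP n (s : 'S_n) (r : rel nat) m :
  [exists A : {set 'I_n}, (#|A| == m) &&
    [forall i in A, forall j in A, (i < j) ==> r (s i) (s j)]]
  <-> chain r m (word s).
Proof.
split=> [/existsP[A /andP[/eqP szA /forall_inP hA]]|].
  have sub : subseq (enum A) (enum 'I_n).
    by rewrite [X in subseq _ X]enumT; apply: filter_subseq.
  exists [seq val (s i) | i <- enum A]; split.
  - exact: map_subseq.
  - rewrite pairwise_map.
    have := subseq_pairwise sub (pairwise_enum_ord n).
    have : all (mem A) (enum A) by apply/allP => i; rewrite mem_enum.
    elim: (enum A) => //= i e IH /andP[iA eA] /andP[/allP ie /(IH eA) ->].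
    rewrite andbT; apply/allP => j je.
    exact: (implyP (forall_inP (hA i iA) j (allP eA j je)) (ie j je)).
  - by rewrite size_map -cardE.
move=> [_ [/subseqP[b sb ->] ]]; rewrite -map_mask pairwise_map size_map => pe sz.
set e := mask b (enum 'I_n) in pe sz.
have le := subseq_pairwise (mask_subseq b _) (pairwise_enum_ord n).
apply/existsP; exists [set i in e]; apply/andP; split.
  by rewrite cardsE -sz; apply/eqP/card_uniqP; rewrite mask_uniq ?enum_uniq.
apply/forall_inP => i; rewrite inE => ie.
apply/forall_inP => j; rewrite inE => je; apply/implyP => ij.
exact: (pairwise_ord_lt pe le ie je ij).
Qed.

Lemma word_perm n (s : 'S_n) : perm_eq (word s) (iota 0 n).
Proof.
have -> : word s = map val (map s (enum 'I_n)) by rewrite -map_comp.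
rewrite -val_enum_ord; apply: perm_map; apply: uniq_perm.
- by rewrite (map_inj_uniq perm_inj) enum_uniq.
- exact: enum_uniq.
move=> i; rewrite mem_enum; apply/mapP; exists (s^-1 i)%g; rewrite ?mem_enum //.
by rewrite permKV.
Qed.

Lemma word_inj n : injective (@word n).
Proof.
move=> s s' /eq_in_map h; apply/permP => i; apply: val_inj.
by apply: h; rewrite mem_enum.
Qed.

Lemma word_surj n w : perm_eq w (iota 0 n) -> exists s : 'S_n, word s = w.
Proof.
move=> pw; have szw : size w = n by rewrite (perm_size pw) size_iota.
have uw : uniq w by rewrite (perm_uniq pw) iota_uniq.
have lt (i : 'I_n) : nth 0 w i < n.
  have : nth 0 w i \in w by rewrite mem_nth ?szw.
  by rewrite (perm_mem pw) mem_iota.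
have inj : injective (fun i => Ordinal (lt i)).
  move=> i j [/eqP]; rewrite nth_uniq ?szw // => /eqP; exact: val_inj.
exists (perm inj); apply: (@eq_from_nth _ 0); rewrite size_map size_enum_ord //.
move=> i lt_i; rewrite (nth_map (Ordinal lt_i)) ?size_enum_ord // permE /=.
by rewrite nth_enum_ord.
Qed.

Lemma contains_incrP n (s : 'S_n) m :
  contains_incr s m <-> chain (monotone true) m (word s).
Proof. exact: (word_chainP s ltn m). Qed.

(** The letters of a permutation are distinct, so that weakly and strictly
    decreasing chains are the same. *)
Lemma contains_decrP n (s : 'S_n) m :
  contains_decr s m <-> chain (monotone false) m (word s).
Proof.
rewrite /contains_decr (word_chainP s gtn m) /=.
have neq : pairwise (fun x y => x != y) (word s).
  by rewrite -uniq_pairwise (perm_uniq (word_perm s)) iota_uniq.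
split; rewrite -{1}(map_id (word s)) -{2}(map_id (word s)); apply: chain_map;
  by apply: sub_pairwise neq => x y; rewrite /monotone /geq /gtn /=; lia.
Qed.

Lemma word_right_extension n (s : 'S_n) (t : 'I_n.+1) :
  word (right_extension s t) = rcons (map (bump t) (word s)) t.
Proof.
rewrite /word /right_extension enum_ordSr map_rcons lift_perm_id -!map_comp.
congr rcons; apply: eq_map => i /=.
have -> : widen_ord (leqnSn n) i = lift ord_max i.
  by apply: val_inj; rewrite /= /bump leqNgt ltn_ord.
by rewrite lift_perm_lift.
Qed.

(** Undoing the shift of the letters from [t] on turns [t + 1] into a second
    copy of [t], standing before the last letter: the pair was decreasing and
    becomes weakly decreasing. *)
Lemma chain_right_extension n (s : 'S_n) (t : 'I_n.+1) incr m :
  chain (monotone incr) m (word (right_extension s t)) <->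
  chain (monotone incr) m (rcons (word s) t).
Proof.
pose g v := if v <= t then v else v.-1.
pose w := word (right_extension s t).
have ew : rcons (word s) t = map g w.
  rewrite /w word_right_extension map_rcons {2}/g leqnn -map_comp.
  rewrite -[in LHS](map_id (word s)); congr rcons; apply: eq_map => x.
  by rewrite /g /bump /=; case: (leqP t x) => tx; case: ifP; lia.
have agree : pairwise (fun a b => monotone incr a b == monotone incr (g a) (g b)) w.
  rewrite /w word_right_extension pairwise_rcons pairwise_map all_map.
  apply/andP; split.
    by apply/allP => x _; rewrite /g /bump; case: incr; rewrite /monotone leqnn /geq /=;
      case: (leqP t x) => tx; case: ifP; lia.
  apply/(pairwiseP 0) => i j _ _ _ /=.
  move: (nth _ _ _) (nth _ _ _) => x y.
  by rewrite /g /bump; case: incr; rewrite /monotone /geq /=;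
    case: (leqP t x) => tx; case: (leqP t y) => ty; do 2!case: ifP; lia.
rewrite ew -/w -[X in X <-> _]/(chain _ m w) -{1}(map_id w).
by split; apply: chain_map; apply: sub_pairwise agree => a b /eqP->; apply/implyP.
Qed.

(** A right extension appends a letter at most [n]; appending a larger letter
    creates the same chains as appending [n]. *)
Lemma right_crucialP n (s : 'S_n) k l :
  right_crucial k l s <-> crucial_tableau k l (rsk (word s)).1.
Proof.
have av n' (s' : 'S_n') : avoids k l (word s') <->
    ~~ contains_incr s' k && ~~ contains_decr s' l.
  rewrite /avoids -(contains_incrP s' k) -(contains_decrP s' l).
  by split=> [[/negP-> /negP->]|/andP[/negP ? /negP]].
have ext (t : 'I_n.+1) : fits k l (insert t (rsk (word s)).1).1 <->
    ~~ (contains_incr (right_extension s t) k ||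
        contains_decr (right_extension s t) l).
  have -> : (insert t (rsk (word s)).1).1 = (rsk (rcons (word s) t)).1.
    by rewrite rsk_rcons.
  rewrite negb_or -av -avoids_fits /avoids.
  by rewrite -(chain_right_extension s t true) -(chain_right_extension s t false).
rewrite /right_crucial /crucial_tableau andbA; split.
  move=> /andP[/av/avoids_fits fT /forallP h]; split => // t.
  case: (ltnP t n.+1) => [lt_t|lt_t].
    by apply/negP => /(ext (Ordinal lt_t)); rewrite h.
  apply/negP => ft; have /negP := h ord_max; apply; apply/negP/(ext ord_max).
  move: ft; have er u : (insert u (rsk (word s)).1).1 = (rsk (rcons (word s) u)).1.
    by rewrite rsk_rcons.
  rewrite !er -!avoids_fits /avoids => -[h1 h2].
  pose g v := if v == n then t else v.
  have lt x : x \in word s -> x < n by rewrite (perm_mem (word_perm s)) mem_iota.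
  have -> : rcons (word s) (@ord_max n) = map id (rcons (word s) n) by rewrite map_id.
  have eg : rcons (word s) t = map g (rcons (word s) n).
    rewrite map_rcons /g eqxx -[in LHS](map_id (word s)); congr rcons.
    by apply/eq_in_map => x /lt; case: eqP => // ->; rewrite ltnn.
  have agree incr : pairwise (fun a b => monotone incr a b ==> monotone incr (g a) (g b))
      (rcons (word s) n).
    rewrite pairwise_rcons; apply/andP; split.
      by apply/allP => x /lt; rewrite /g; case: incr; rewrite /monotone /geq /= eqxx; case: eqP; lia.
    apply/(pairwiseP 0) => i j; rewrite !inE => /(mem_nth 0)/lt + /(mem_nth 0)/lt + _.
    move: (nth _ _ _) (nth _ _ _) => x y.
    by rewrite /g; case: incr; rewrite /monotone /geq /=; do 2!case: eqP; lia.
  by split=> c; [apply: h1 | apply: h2]; rewrite eg;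
    [apply: chain_map (agree true) c | apply: chain_map (agree false) c].
move=> [/avoids_fits/av -> h]; apply/forallP => t; apply/negPn/negP => /ext.
exact/negP.
Qed.

Theorem theorem15 (k l n : nat) (hk : 0 < k) (hl : 0 < l) (hn : 0 < n)
    (hkln : k + l <= n + 3) (hnkl : n < (k - 1) * (l - 1)) :
  num_right_crucial n k l < num_right_crucial n.+1 k l.
Proof.
have step (s : 'S_n) : exists s' : 'S_n.+1, right_crucial k l s ->
    [/\ right_crucial k l s',
        remove_letter n (rsk (word s')).1 = (rsk (word s)).1
      & exists i, (rsk (word s')).2 = rcons (rsk (word s)).2 i].
  case: (boolP (right_crucial k l s)) => [/right_crucialP cs|_]; last by exists 1%g.
  have [w [i [pw e2 e1 cw]]] := crucial_grow hk hnkl (word_perm s) cs.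
  have [s' es'] := word_surj pw; exists s' => _; rewrite es'; split => //.
    by apply/right_crucialP; rewrite es'.
  by exists i.
have [f hf] := fin_all_exists step.
have [w [pw cw ncw]] := exists_ungrown_crucial hkln hnkl.
have [s0 es0] := word_surj pw.
set A := [set s : 'S_n | right_crucial k l s].
set B := [set s : 'S_n.+1 | right_crucial k l s].
(* The record of the image ends with the index of the row of the new cell. *)
have f_inj : {in A &, injective f}.
  move=> s s'; rewrite !inE => /hf[_ h1 [i h2]] /hf[_ h1' [i' h2']] e.
  apply/word_inj/rsk_inj; move: h1 h2; rewrite e h1' h2' => e1 /eqP.
  rewrite eqseq_rcons => /andP[/eqP e2 _].
  by move: e1 e2; case: (rsk (word s)) => ? ?; case: (rsk (word s')) => ? ? /= -> ->.
rewrite /num_right_crucial -/A -/B -(card_in_imset f_inj).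
apply: proper_card; apply/properP; split.
  by apply/subsetP => _ /imsetP[s + ->]; rewrite !inE => /hf[].
exists s0; first by rewrite inE; apply/right_crucialP; rewrite es0.
apply/imsetP => -[s]; rewrite inE => cs e0; apply: ncw.
by have [_ e1 _] := hf s cs; rewrite -es0 e0 e1; apply/right_crucialP.
Qed.
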